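(* Let $P$ be a poset. (1) The space $\mathrm{UF}(P)$ is $T_0$. (2) The space $\mathrm{MF}(P)$ is $T_1$. (3) If $\mathrm{UF}(P)$ is $T_1$, then every unbounded filter on $P$ is maximal, and thus $\mathrm{UF}(P)=\mathrm{MF}(P)$.
   Context: A poset is a set $P$ with a reflexive, antisymmetric, transitive relation $\preceq$; $p\prec q$ means $p\preceq q$ and $p\neq q$. A filter on $P$ is a nonempty subset $F\subseteq P$ such that (1) for all $p,q\in F$ there is $r\in F$ with $r\preceq p$ and $r\preceq q$, and (2) if $p\in F$, $q\in P$ and $p\preceq q$ then $q\in F$. A filter $F$ is unbounded if there is no $r\in P$ with $r\prec q$ for every $q\in F$; it is maximal if no strictly larger filter contains it (every maximal filter is unbounded). $\mathrm{UF}(P)$ is the set of unbounded filters on $P$, with the topology having basis $\{N_p : p\in P\}$, where $N_p=\{F\in \mathrm{UF}(P) : p\in F\}$; $\mathrm{MF}(P)\subseteq \mathrm{UF}(P)$ is the set of maximal filters, with the subspace topology. *)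

(* Defs.v *)
From HB Require Import structures.
From mathcomp Require Import all_boot all_order.
From mathcomp Require Import boolp classical_sets topology.
Set Implicit Arguments.
Unset Strict Implicit.
Unset Printing Implicit Defensive.
Import Order.TTheory.
Local Open Scope classical_set_scope.
Local Open Scope order_scope.

Section PosetFilters.
Context {d : Order.disp_t} {P : porderType d}.
Implicit Types F G : set P.

Definition poset_filter F : Prop :=
  [/\ F !=set0,
      forall p q, F p -> F q -> exists r, [/\ F r, r <= p & r <= q]
    & forall p q, F p -> p <= q -> F q].

Definition unbounded_filter F : Prop :=
  poset_filter F /\ ~ exists r, forall q, F q -> r < q.

Definition maximal_filter F : Prop :=
  poset_filter F /\ ~ exists G, poset_filter G /\ F `<` G.

Lemma maximal_filter_unbounded F : maximal_filter F -> unbounded_filter F.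
Proof.
move=> [fF maxF]; split=> // -[r rF]; apply: maxF.
exists [set p | r <= p]; split.
  split; first by exists r => /=.
    by move=> p q /= rp rq; exists r.
  by move=> p q /= rp pq; exact: le_trans pq.
split=> [p /rF /ltW //|rleF].
by have := rF r (rleF r (lexx r)); rewrite ltxx.
Qed.

End PosetFilters.

Definition UF d (P : porderType d) : Type :=
  set_type [set F : set P | unbounded_filter F].

Section UFTopology.
Context {d : Order.disp_t} {P : porderType d}.

HB.instance Definition _ := SubChoice.copy (UF P)
  (set_type [set F : set P | unbounded_filter F]).

Definition UF_set (F : UF P) : set P := \val F.

Lemma UF_setP (F : UF P) : unbounded_filter (UF_set F).
Proof. exact: set_mem (valP F). Qed.

Definition UF_nbhd (p : P) : set (UF P) := [set F | UF_set F p].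

(* The base is indexed by its own members rather than by P, because the index
   type of isBaseTopological must be pointed and P may be empty. *)
Let UF_base : set (set (UF P)) := range UF_nbhd.

Let UF_base_cover : \bigcup_(B in UF_base) id B = setT.
Proof.
rewrite -subTset => F _; have [[[p Fp] _ _] _] := UF_setP F.
by exists (UF_nbhd p) => //; exists p.
Qed.

Let UF_base_join (A B : set (UF P)) (F : UF P) :
  UF_base A -> UF_base B -> id A F -> id B F ->
  exists C, [/\ UF_base C, id C F & id C `<=` id A `&` id B].
Proof.
move=> [p _ <-] [q _ <-] /= Fp Fq.
have [[_ dirF _] _] := UF_setP F; have [r [Fr rp rq]] := dirF _ _ Fp Fq.
exists (UF_nbhd r); split=> [|//|G Gr]; first by exists r.
by have [[_ _ upG] _] := UF_setP G; split; [exact: upG rp|exact: upG rq].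
Qed.

HB.instance Definition _ :=
  isBaseTopological.Build (UF P) UF_base_cover UF_base_join.

End UFTopology.

(* As a type, MF P is the sigma type set_type (MF P), which carries the subspace
   topology induced by UF P. *)
Definition MF d (P : porderType d) : set (UF P) :=
  [set F | maximal_filter (UF_set F)].
Arguments MF {d} P _.

Lemma image_UF_set_MF d (P : porderType d) :
  UF_set @` MF P = [set F : set P | maximal_filter F].
Proof.
apply/seteqP; split=> [_ [F mF <-] //|F mF].
by exists (exist _ F (mem_set (maximal_filter_unbounded mF))).
Qed.

(* Main.v *)
(* Every open set of UF(P) is upward closed under inclusion of filters, and a
   point p of F outside G gives an open set N_p separating F from G; so
   separation is governed by non-inclusion.  Distinct filters fail one inclusion,
   distinct maximal filters fail both.  Since a filter extending an unbounded
   filter is again unbounded, a non-maximal unbounded filter lies strictly below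
   a point of UF(P), which contradicts T_1. *)
Require Import Defs.
From mathcomp Require Import all_boot all_order.
From mathcomp Require Import boolp classical_sets topology.
Local Open Scope classical_set_scope.

Lemma UF_set_inj {d : Order.disp_t} {P : porderType d} :
  injective (@UF_set d P).
Proof. exact: val_inj. Qed.

Lemma open_UF_nbhd {d : Order.disp_t} {P : porderType d} (p : P) :
  open (UF_nbhd p).
Proof.
(* Open sets are unions of subfamilies of the base; here one member suffices. *)
exists [set UF_nbhd p]; last by rewrite bigcup_set1.
by move=> _ ->; exists p.
Qed.

Lemma open_UF_basis {d : Order.disp_t} {P : porderType d} {A : set (UF P)}
    {F : UF P} :
  open A -> A F -> exists2 p, UF_set F p & UF_nbhd p `<=` A.
Proof.
move=> [D sD <-] [B DB BF]; have [p _ eB] := sD _ DB; subst B.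
by exists p => // G Gp; exists (UF_nbhd p).
Qed.

(** Some basic set [UF_nbhd p] lies between [F] and [A], and membership in it only asks for [p],
    which [G] inherits from [F]. *)
Lemma open_subset_UF {d : Order.disp_t} {P : porderType d} {A : set (UF P)}
    {F G : UF P} :
  open A -> UF_set F `<=` UF_set G -> A F -> A G.
Proof.
by move=> oA sFG /(open_UF_basis oA)[p Fp]; apply; exact: sFG.
Qed.

Lemma maximal_filter_subset_eq {d : Order.disp_t} {P : porderType d}
    {F G : set P} :
  maximal_filter F -> poset_filter G -> F `<=` G -> F = G.
Proof.
move=> [_ maxF] fG sFG; apply/seteqP; split=> //.
by apply: contrapT => nsGF; apply: maxF; exists G.
Qed.

(** A strict lower bound of [G] is also one of the smaller set [F]. *)
Lemma unbounded_filter_subset {d : Order.disp_t} {P : porderType d}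
    {F G : set P} :
  unbounded_filter F -> poset_filter G -> F `<=` G -> unbounded_filter G.
Proof.
by move=> [_ ubF] fG sFG; split=> // -[r rG]; apply: ubF; exists r => q /sFG /rG.
Qed.

Lemma kolmogorov_UF (d : Order.disp_t) (P : porderType d) :
  kolmogorov_space (UF P).
Proof.
move=> F G /eqP neFG.
have [sFG|/existsNP[p /not_implyP[Fp nGp]]] := pselect (UF_set F `<=` UF_set G).
  have /existsNP[p /not_implyP[Gp nFp]] : ~ (UF_set G `<=` UF_set F).
    by move=> sGF; apply/neFG/UF_set_inj/seteqP.
  exists (UF_nbhd p); right; split; apply/mem_set => //.
  exact: open_nbhs_nbhs (conj (open_UF_nbhd p) Gp).
exists (UF_nbhd p); left; split; apply/mem_set => //.
exact: open_nbhs_nbhs (conj (open_UF_nbhd p) Fp).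
Qed.

Lemma accessible_MF (d : Order.disp_t) (P : porderType d) :
  accessible_space (set_type (MF P)).
Proof.
move=> F G /eqP neFG.
have /existsNP[p /not_implyP[Fp nGp]] :
    ~ (UF_set (\val F) `<=` UF_set (\val G)).
  (* Maximality of [F] turns the inclusion into an equality. *)
  move=> sFG; apply/neFG/val_inj/UF_set_inj.
  apply: maximal_filter_subset_eq sFG; first exact: set_mem (valP F).
  by have [] := UF_setP (\val G).
(* The trace of [UF_nbhd p] on the subspace. *)
exists (\val @^-1` UF_nbhd p); split; [|exact/mem_set|exact/mem_set].
by exists (UF_nbhd p) => //; exact: open_UF_nbhd.
Qed.

Lemma accessible_UF_maximal {d : Order.disp_t} {P : porderType d}
    {F : set P} :
  accessible_space (UF P) -> unbounded_filter F -> maximal_filter F.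
Proof.
move=> T1 uF; split; first by case: uF.
move=> [G [fG [sFG nsGF]]].
have uG := unbounded_filter_subset uF fG sFG.
pose F' : UF P := exist _ F (mem_set uF).
pose G' : UF P := exist _ G (mem_set uG).
have neFG : F' != G' by apply/eqP => -[eFG]; apply: nsGF; rewrite eFG.
(* The order of the pair matters: [A] contains the smaller filter and misses the larger, against
   upward closure of open sets. *)
have [A [oA /set_mem AF /set_mem]] := T1 _ _ neFG; apply.
exact: (open_subset_UF (F := F')).
Qed.

Theorem theorem3p1 (d : Order.disp_t) (P : porderType d) :
  [/\ kolmogorov_space (UF P),
      accessible_space (set_type (MF P))
    & accessible_space (UF P) ->
      (forall F : set P, unbounded_filter F -> maximal_filter F) /\
      [set: UF P] = MF P].
Proof.
split; [exact: kolmogorov_UF|exact: accessible_MF|move=> T1].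
have uF_max F := accessible_UF_maximal (F := F) T1.
split=> //; apply/seteqP; split=> // F _.
exact/uF_max/UF_setP.
Qed.
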